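(* Let $d \ge 1$, let $k$ be a non-negative integer and let $A \subseteq \mathbb{R}^d$ be a generic thin Delone set. Then every point $x \in \mathbb{R}^d$ that is generic with respect to $A$ belongs to exactly $\binom{d+k}{d}$ $k$-hefty simplices of $A$.
   Context: A set $A \subseteq \mathbb{R}^d$ is locally finite if every closed ball contains only finitely many points of $A$, and coarsely dense if every closed half-space contains at least one point of $A$; it is a thin Delone set if it has both properties. $A$ is generic if no $d+1$ of its points lie on a common affine hyperplane and no $d+2$ of its points lie on a common $(d-1)$-sphere. For a generic $A$, any $d+1$ of its points span a $d$-simplex and lie on a unique $(d-1)$-sphere, its circumscribed sphere; a point is inside a $(d-1)$-sphere if it lies in the interior of the closed ball bounded by it. A $d$-simplex with vertices in $A$ is $k$-hefty if exactly $k$ points of $A$ lie inside its circumscribed sphere. A point $x$ is generic with respect to $A$ if $x \notin A$ and $A \cup \{x\}$ is generic. Simplices are closed (convex hulls of their vertices). *)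

(* Defs.v *)
From mathcomp Require Import all_boot all_order all_algebra.
From mathcomp Require Import finmap.
From mathcomp Require Import all_classical all_reals all_analysis.

Set Implicit Arguments.
Unset Strict Implicit.
Unset Printing Implicit Defensive.

Import Order.TTheory GRing.Theory Num.Theory.
Import numFieldNormedType.Exports.
Local Open Scope classical_set_scope.
Local Open Scope card_scope.
Local Open Scope ring_scope.

(* R^d is 'rV[R]_d. The norm that the library puts on matrices is the sup norm,
   hence the explicit Euclidean norm; both induce the product topology carried
   by 'rV[R]_d, so the library's interior [A°] is the Euclidean one. *)
Section EuclideanSpace.
Context {R : realType} {d : nat}.
Implicit Types (A : set 'rV[R]_d) (V : {fset 'rV[R]_d}) (x c u : 'rV[R]_d).

Definition dot (u v : 'rV[R]_d) : R := \sum_(i < d) u ord0 i * v ord0 i.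

Definition enorm u : R := Num.sqrt (dot u u).

Definition eclosed_ball c (r : R) : set 'rV[R]_d :=
  [set x | enorm (x - c) <= r].

Definition esphere c (r : R) : set 'rV[R]_d := [set x | enorm (x - c) = r].

Definition closed_halfspace u (b : R) : set 'rV[R]_d := [set x | dot u x <= b].

Definition hyperplane u (b : R) : set 'rV[R]_d := [set x | dot u x = b].

Definition inside_sphere c (r : R) : set 'rV[R]_d := (eclosed_ball c r)°.

Definition locally_finite A : Prop :=
  forall c (r : R), finite_set (A `&` eclosed_ball c r).

Definition coarsely_dense A : Prop :=
  forall u (b : R), u != 0 -> exists x, A x /\ closed_halfspace u b x.

Definition thin_Delone A : Prop := locally_finite A /\ coarsely_dense A.

Definition on_common_hyperplane V : Prop :=
  exists u (b : R), u != 0 /\ [set` V] `<=` hyperplane u b.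

Definition on_common_sphere V : Prop :=
  exists c (r : R), 0 < r /\ [set` V] `<=` esphere c r.

Definition generic A : Prop :=
  (forall V, [set` V] `<=` A -> #|` V| = d.+1 -> ~ on_common_hyperplane V) /\
  (forall V, [set` V] `<=` A -> #|` V| = d.+2 -> ~ on_common_sphere V).

Definition generic_wrt A x : Prop := ~ A x /\ generic (x |` A).

Definition conv_hull V : set 'rV[R]_d :=
  [set x | exists t : 'rV[R]_d -> R,
     [/\ forall v, v \in V -> 0 <= t v,
         \sum_(v <- V) t v = 1
       & x = \sum_(v <- V) t v *: v]].

(* In R^d, d+1 points are affinely independent iff no hyperplane contains them. *)
Definition is_dsimplex V (s : set 'rV[R]_d) : Prop :=
  [/\ #|` V| = d.+1, ~ on_common_hyperplane V & s = conv_hull V].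

(* The sphere in the existential is the circumscribed one: it is unique, since
   the vertices are affinely independent. *)
Definition hefty A (k : nat) (s : set 'rV[R]_d) : Prop :=
  exists V, [/\ [set` V] `<=` A, is_dsimplex V s &
    exists c (r : R), [/\ 0 < r, [set` V] `<=` esphere c r &
      A `&` inside_sphere c r #= `I_k]].

End EuclideanSpace.

(* Main.v *)
Require Import Defs.
From mathcomp Require Import all_boot all_order all_algebra.
From mathcomp Require Import zify ring lra.

(* A sphere through d+1 points v is an affine function [u.(v - x) + h] that
   interpolates [|v - x|^2], and a point is inside it iff that function exceeds
   [|v - x|^2] there. So the 0-hefty simplex around x is the optimal basis of the
   linear programme that minimises [\sum_v t_v |v - x|^2] over the convex
   combinations [\sum_v t_v v = x]; by genericity and coarse density it exists
   and is unique. This also holds for A minus any finite set B, where the 0-hefty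
   simplices are the simplices of A that avoid B and have all their inner points
   in B. Counting the pairs (B, simplex) with B an m-subset of a window of n
   points, large enough to contain all simplices around x with at most k inner
   points, gives ['C(n, m) = \sum_(j <= m) f_j 'C(n - d - 1 - j, m - j)] for all
   [m <= k], where [f_j] counts the j-hefty simplices around x. These equations
   determine the [f_j], and [f_j = 'C(d + j, d)] solves them. *)

Set Implicit Arguments.
Unset Strict Implicit.
Unset Printing Implicit Defensive.

(** * Binomial convolution and double counting *)

Section Counting.
Local Open Scope nat_scope.

(** This compares the coefficients of [z ^ m] when the power series of [(1 - z) ^ -(p + 1)] and
    [(1 - z) ^ -(q + 1)] are multiplied. The proof uses Pascal's rule, by induction on [p] and then
    on [m]. *)
Lemma sum_bin_conv p q m :
  \sum_(j < m.+1) 'C(p + j, j) * 'C(q + (m - j), m - j) = 'C((p + q).+1 + m, m).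
Proof.
elim: p m => [|p IHp] m.
  elim: m => [|m IHm]; first by rewrite big_ord_recl big_ord0 !bin0.
  rewrite big_ord_recl bin0 mul1n subn0.
  have -> : \sum_(i < m.+1) 'C(0 + lift ord0 i, lift ord0 i) *
      'C(q + (m.+1 - lift ord0 i), m.+1 - lift ord0 i) = 'C(q.+1 + m, m).
    by rewrite -IHm; apply: eq_bigr => j _; rewrite lift0 !add0n !binn subSS.
  by rewrite addnS add0n addSn addnS binS.
elim: m => [|m IHm]; first by rewrite big_ord_recl big_ord0 !bin0.
transitivity ('C((p + q).+1 + m.+1, m.+1) + 'C((p.+1 + q).+1 + m, m)); last first.
  by rewrite !addSn !addnS binS.
rewrite -(IHp m.+1) -IHm !(big_ord_recl m.+1) !bin0 -addnA; congr (_ + _).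
rewrite -big_split; apply: eq_bigr => j _.
by rewrite lift0 subSS addnS binS mulnDl addSnnS.
Qed.

(** Removing [I] from [B] leaves an arbitrary set of [m - #|I|] elements outside [V :|: I]. *)
Lemma card_between (T : finType) (V I : {set T}) m :
  [disjoint V & I] ->
  #|[set B : {set T} | (#|B| == m) && ((I \subset B) && [disjoint B & V])]| =
    if #|I| <= m then 'C(#|T| - #|V| - #|I|, m - #|I|) else 0.
Proof.
move=> dVI; case: leqP => [leIm|ltmI]; last first.
  apply: eq_card0 => B; rewrite !inE; apply/negP => /and3P[/eqP Bm IB _].
  by have := subset_leq_card IB; rewrite Bm leqNgt ltmI.
have cC : #|~: (V :|: I)| = #|T| - #|V| - #|I|.
  have := cardsC (V :|: I); have := cardsUI V I.
  by move: dVI; rewrite -setI_eq0 => /eqP ->; rewrite cards0; lia.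
rewrite -cC -cards_draws; set S := (X in _ = #|X|).
have inS D : D \in S = [&& D \subset ~: V, D \subset ~: I & #|D| == m - #|I|].
  by rewrite inE setCU subsetI -andbA.
rewrite -(card_in_imset (f := fun D => I :|: D) (D := S)); last first.
  move=> D E; rewrite !inS => /and3P[_ DI _] /and3P[_ EI _] eDE.
  apply/setP => a; have := congr1 (fun X : {set T} => a \in X) eDE; rewrite !inE.
  case: (boolP (a \in I)) => [aI|//] _.
  have notin (X : {set T}) : X \subset ~: I -> (a \in X) = false.
    by move=> XI; apply/negP => /(subsetP XI); rewrite inE aI.
  by rewrite !notin.
apply: eq_card => B; rewrite inE; apply/idP/imsetP => [/and3P[/eqP Bm IB dBV]|].
  exists (B :\: I); last by rewrite -[LHS](setID B I) (setIidPr IB).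
  rewrite inS cardsD (setIidPr IB) Bm eqxx andbT setDE !subIset ?subxx ?orbT//.
  by rewrite -disjoints_subset dBV.
case=> D; rewrite inS => /and3P[DV DI /eqP cD] ->.
rewrite subsetUl /=; apply/andP; split.
  have := cardsUI I D; rewrite (_ : I :&: D = finset.set0); last first.
    by apply/eqP; rewrite setI_eq0 disjoint_sym disjoints_subset.
  by rewrite cards0 cD; lia.
by rewrite disjoints_subset subUset DV andbT -disjoints_subset disjoint_sym.
Qed.

(* Double counting the pairs [(B, V)] with [#|B| = m] gives
   ['C(n, m) = \sum_j f_j * 'C(n - d - 1 - j, m - j)] for [n = #|T|], which
   determines the numbers [f_j] of [V] with [#|I V| = j] recursively. *)
Lemma card_bases_of_level (T : finType) (d K : nat) (P : pred {set T})
    (I : {set T} -> {set T}) :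
  (forall V, P V -> #|V| = d.+1) -> (forall V, P V -> [disjoint V & I V]) ->
  (forall B : {set T}, #|B| <= K ->
     #|[set V | P V && ((I V \subset B) && [disjoint B & V])]| = 1) ->
  forall j, j <= K -> #|[set V | P V && (#|I V| == j)]| = 'C(d + j, d).
Proof.
move=> PV PI PB; set n := #|T|.
(* A set of size [K] and the basis disjoint from it both fit into [T], so the truncated subtractions
   below are exact. That [K <= n] is not known yet, hence the minimum. *)
have Kn : K + d.+1 <= n.
  have [B cB] : exists B : {set T}, #|B| = minn K n.
    have : 0 < #|[set A : {set T} | A \subset [set: T] & #|A| == minn K n]|.
      by rewrite cards_draws cardsT bin_gt0 geq_minr.
    by case/card_gt0P => B; rewrite inE => /andP[_ /eqP]; exists B.
  have /PB/eqP/cards1P[V /setP/(_ V)] : #|B| <= K by rewrite cB geq_minl.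
  rewrite !inE eqxx => /and3P[/PV cV _ dBV].
  have := subset_leq_card (subsetT (B :|: V)); rewrite cardsT -/n; have := cardsUI B V.
  by move: dBV; rewrite -setI_eq0 => /eqP ->; rewrite cards0 cV cB; lia.
pose f j := #|[set V | P V && (#|I V| == j)]|.
have count m : m <= K ->
    'C(n, m) = \sum_(j < m.+1) f j * 'C(n - d.+1 - j, m - j).
  move=> mK.
  have -> : 'C(n, m) = \sum_(B : {set T} | #|B| == m)
      \sum_(V | P V) ((I V \subset B) && [disjoint B & V] : nat).
    transitivity (\sum_(B : {set T} | #|B| == m) 1).
      have := cards_draws [set: T] m; rewrite cardsT => <-.
      by rewrite sum1dep_card; apply: eq_card => B; rewrite !inE subsetT.
    apply: eq_bigr => B /eqP cB; rewrite -big_mkcondr /= sum1dep_card.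
    by rewrite -(PB B) ?cB //; apply: eq_card => V; rewrite !inE.
  rewrite exchange_big /=.
  transitivity (\sum_(V | P V)
      (if #|I V| <= m then 'C(n - d.+1 - #|I V|, m - #|I V|) else 0)).
    apply: eq_bigr => V pV; rewrite -big_mkcondr /= sum1dep_card.
    rewrite -(PV _ pV) -card_between ?PI //.
  rewrite -big_mkcondr /=.
  rewrite (partition_big (fun V => inord #|I V| : 'I_m.+1) predT) //=.
  apply: eq_bigr => j _; rewrite /f -sum1dep_card big_distrl /=.
  have lej : j <= m by rewrite -ltnS.
  apply: eq_big => V.
    rewrite -andbA; case: (P V) => //=; apply/andP/eqP => [[lm /eqP <-]|->].
      by rewrite inordK.
    by rewrite lej; split=> //; apply/eqP/val_inj; rewrite /= inordK.
  by move=> /andP[/andP[_ lm] /eqP <-]; rewrite inordK // mul1n.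
move=> j; elim/ltn_ind: j => j IHj jK.
have := count _ jK.
(* The convolution says that the binomials solve the [j]-th equation. All terms before the last
   agree by induction, and the last has coefficient 1. *)
have := sum_bin_conv d (n - d.+1 - j) j.
have -> : (d + (n - d.+1 - j)).+1 + j = n by lia.
rewrite !big_ord_recr /= subnn !bin0 !muln1 -/(f j) => <-.
have binDr i : 'C(d + i, d) = 'C(d + i, i).
  by rewrite -(bin_sub (leq_addr i d)) addKn.
rewrite binDr.
rewrite (eq_bigr (fun i : 'I_j => f i * 'C(n - d.+1 - i, j - i))); first by move/addnI.
move=> i _; have ltij := ltn_ord i.
rewrite /f IHj // 1?ltnW ?(leq_trans ltij) // binDr.
by congr (_ * 'C(_, _)); lia.
Qed.

End Counting.

From mathcomp Require Import finmap.
From mathcomp Require Import all_classical all_reals all_analysis.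

Local Open Scope classical_set_scope.
Local Open Scope card_scope.

Import Order.TTheory GRing.Theory Num.Theory.
Import numFieldNormedType.Exports.

(** * Dot products, affine functions and barycentric coordinates *)

Section LinearAlgebra.
Local Open Scope ring_scope.
Context {R : realType} {d : nat}.
Implicit Types (u v w x a : 'rV[R]_d) (V : {fset 'rV[R]_d}).

Lemma dotC u v : dot u v = dot v u.
Proof. by apply: eq_bigr => i _; rewrite mulrC. Qed.

Lemma dotDr u v w : dot u (v + w) = dot u v + dot u w.
Proof. by rewrite -big_split; apply: eq_bigr => i _; rewrite mxE mulrDr. Qed.

Lemma dotZr u (k : R) v : dot u (k *: v) = k * dot u v.
Proof. by rewrite big_distrr; apply: eq_bigr => i _; rewrite mxE mulrCA. Qed.

Lemma dotNr u v : dot u (- v) = - dot u v.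
Proof. by rewrite -scaleN1r dotZr mulN1r. Qed.

Lemma dotDl u v w : dot (u + v) w = dot u w + dot v w.
Proof. by rewrite !(dotC _ w) dotDr. Qed.

Lemma dotZl (k : R) u v : dot (k *: u) v = k * dot u v.
Proof. by rewrite !(dotC _ v) dotZr. Qed.

Lemma dotNl u v : dot (- u) v = - dot u v.
Proof. by rewrite !(dotC _ v) dotNr. Qed.

Lemma dotr0 u : dot u 0 = 0.
Proof. by rewrite -(scale0r 0) dotZr mul0r. Qed.

Lemma dot0l u : dot 0 u = 0.
Proof. by rewrite dotC dotr0. Qed.

Definition dotE := (dotDr, dotDl, dotNr, dotNl, dotZr, dotZl).

Lemma dot_sumr (I : Type) (s : seq I) (F : I -> 'rV[R]_d) u :
  dot u (\sum_(i <- s) F i) = \sum_(i <- s) dot u (F i).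
Proof. by apply: (big_morph (dot u)) => [v w|]; rewrite ?dotDr ?dotr0. Qed.

Lemma dot_ge0 u : 0 <= dot u u.
Proof. by apply: sumr_ge0 => i _; rewrite -expr2 sqr_ge0. Qed.

Lemma dot_eq0 u : (dot u u == 0) = (u == 0).
Proof.
apply/eqP/eqP => [|->]; last exact: dotr0.
move=> /psumr_eq0P u0; apply/rowP => i; rewrite mxE; apply/eqP.
by rewrite -[_ == 0]sqrf_eq0 expr2 u0 // => j _; rewrite -expr2 sqr_ge0.
Qed.

Lemma dot_gt0 u : (0 < dot u u) = (u != 0).
Proof. by rewrite lt_def dot_ge0 andbT dot_eq0. Qed.

Lemma affine_vanish x V u h : #|` V| = d.+1 -> ~ on_common_hyperplane V ->
  (forall v, v \in V -> dot u (v - x) + h = 0) -> u = 0 /\ h = 0.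
Proof.
move=> cV nV uV.
have u0 : u = 0.
  apply/eqP; apply: contraPT isT => u0 _; apply: nV.
  exists u, (dot u x - h); split => // v /uV; rewrite /hyperplane /= !dotE; lra.
split=> //; move: cV uV; rewrite u0.
case: (fset_0Vmem V) => [->|[v vV] _ /(_ v vV)]; first by rewrite cardfs0.
by rewrite dot0l add0r.
Qed.

(** Row [i] is the [i]-th point of [V] in homogeneous coordinates, with 1 in column 0; multiplying
    by a column vector evaluates an affine function on [V]. *)
Let M V : 'M[R]_d.+1 :=
  \matrix_(i, j) oapp (fun j' => (nth 0 V i : 'rV_d) ord0 j') 1 (unlift ord0 j).

Let rowM (z : 'I_d.+1 -> R) v :
  \sum_j oapp (fun j' => v ord0 j') 1 (unlift ord0 j) * z j =
  dot (\row_j z (lift ord0 j)) v + z ord0.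
Proof.
rewrite big_ord_recl unlift_none mul1r addrC; congr (_ + _).
by apply: eq_bigr => j _; rewrite liftK mxE mulrC.
Qed.

(** A kernel vector would be an affine function that vanishes on [V], hence zero. *)
Let unitM V : #|` V| = d.+1 -> ~ on_common_hyperplane V -> M V \in unitmx.
Proof.
move=> cV nV; rewrite -unitmx_tr unitmxE unitfE.
apply/negP => /det0P[z z0 zM].
have uV v : v \in V -> dot (\row_j z ord0 (lift ord0 j)) (v - 0) + z ord0 ord0 = 0.
  move=> vV; have iV : (index v V < d.+1)%N by rewrite -cV index_mem.
  rewrite subr0; have /matrixP/(_ ord0 (Ordinal iV)) := zM; rewrite !mxE => zi.
  rewrite -rowM -[RHS]zi; apply: eq_bigr => j _; rewrite !mxE mulrC /=.
  by rewrite nth_index.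
have [/rowP u0 h0] := affine_vanish cV nV uV.
case/eqP: z0; apply/rowP => j; rewrite mxE; case: (unliftP ord0 j) => [i|] -> //.
by have := u0 i; rewrite !mxE.
Qed.

Lemma affine_interpolation x V (b : 'rV[R]_d -> R) :
  #|` V| = d.+1 -> ~ on_common_hyperplane V ->
  exists u h, forall v, v \in V -> dot u (v - x) + h = b v.
Proof.
move=> cV nV; pose B : 'cV[R]_d.+1 := \col_i b (nth 0 V i).
pose z := invmx (M V) *m B.
pose u : 'rV[R]_d := \row_j z (lift ord0 j) ord0.
exists u, (z ord0 ord0 + dot u x) => v vV.
have iV : (index v V < d.+1)%N by rewrite -cV index_mem.
have /matrixP/(_ (Ordinal iV) ord0) : M V *m z = B by rewrite mulKVmx ?unitM.
rewrite [X in X = _ -> _]mxE [X in _ = X -> _]mxE /= nth_index // => <-.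
under [RHS]eq_bigr => j _ do rewrite [M _ _ _]mxE /= nth_index //.
by rewrite (rowM (fun j => z j ord0)) /= -/u !dotE; ring.
Qed.

(** Pairing both relations with the affine function that is 1 at [w] and 0 at the other points
    isolates [s w]. *)
Lemma affine_independence V (s : 'rV[R]_d -> R) :
  #|` V| = d.+1 -> ~ on_common_hyperplane V ->
  \sum_(v <- V) s v = 0 -> \sum_(v <- V) s v *: v = 0 ->
  forall v, v \in V -> s v = 0.
Proof.
move=> cV nV s0 sv0 w wV.
have [u [h uh]] := affine_interpolation 0 (fun v => (v == w)%:R) cV nV.
have {}uh v : v \in V -> dot u v + h = (v == w)%:R by move=> /uh; rewrite subr0.
have : \sum_(v <- V) s v * (dot u v + h) = 0.
  under eq_bigr => v _ do rewrite mulrDr -dotZr.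
  by rewrite big_split /= -dot_sumr sv0 dotr0 -mulr_suml s0 mul0r addr0.
rewrite (big_fsetD1 w) //= uh // eqxx mulr1.
rewrite big_seq big1 ?addr0 // => v; rewrite in_fsetD1 => /andP[vw vV].
by rewrite uh // (negbTE vw) mulr0.
Qed.

Lemma barycentric V a : #|` V| = d.+1 -> ~ on_common_hyperplane V ->
  exists s : 'rV[R]_d -> R,
    \sum_(v <- V) s v = 1 /\ \sum_(v <- V) s v *: v = a.
Proof.
move=> cV nV.
(* [b] is [a] in homogeneous coordinates, and [z] expresses it through the rows of [M V]. *)
pose b : 'rV[R]_d.+1 := \row_j oapp (fun j' => a ord0 j') 1 (unlift ord0 j).
pose z := b *m invmx (M V); pose s v := z ord0 (inord (index v V)).
have zM : z *m M V = b by rewrite mulmxKV ?unitM.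
have sumV (F : R -> 'rV[R]_d -> R) : \sum_(v <- V) F (s v) v =
    \sum_(i < d.+1) F (z ord0 i) (nth 0 V i).
  have sV : size V = d.+1 := cV.
  rewrite (big_nth 0) sV big_mkord; apply: eq_bigr => i _.
  by rewrite /s index_uniq ?inord_val ?fset_uniq ?sV.
exists s; split.
  rewrite (sumV (fun r _ => r)); have /rowP/(_ ord0) := zM.
  rewrite [X in X = _ -> _]mxE [X in _ = X -> _]mxE unlift_none /= => <-.
  by apply: eq_bigr => i _; rewrite [M _ _ _]mxE unlift_none mulr1.
apply/rowP => j; rewrite summxE.
under eq_bigr => v _ do rewrite mxE.
rewrite (sumV (fun r v => r * v ord0 j)).
have /rowP/(_ (lift ord0 j)) := zM.
rewrite [X in X = _ -> _]mxE [X in _ = X -> _]mxE liftK /= => <-.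
by apply: eq_bigr => i _; rewrite [M _ _ _]mxE liftK.
Qed.

End LinearAlgebra.

(** * The ratio test and Gordan's alternative *)

Section Gordan.
Local Open Scope ring_scope.
Context {R : realType}.

Lemma seq_argmin (T : eqType) (f : T -> R) (s : seq T) v : v \in s ->
  exists2 m, m \in s & forall w, w \in s -> f m <= f w.
Proof.
elim: s v => // a s IHs v _; case: s IHs => [_|b s /(_ b)].
  by exists a; rewrite ?inE // => w; rewrite inE => /eqP ->.
rewrite mem_head => /(_ isT)[m ms mP].
case: (leP (f a) (f m)) => fam.
  exists a; rewrite ?mem_head // => w; rewrite inE => /predU1P[->//|/mP].
  exact: le_trans.
exists m; first by rewrite inE ms orbT.
by move=> w; rewrite inE => /predU1P[->|/mP//]; exact: ltW.
Qed.

(** The ratio test of the simplex method: [th] is the least ratio [t w / g w] over the positive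
    [g w], thus the longest step along [- g] that keeps all weights non-negative. *)
Lemma ratio_test (T : eqType) (s : seq T) (t g : T -> R) v :
  (forall w, w \in s -> 0 <= t w) -> v \in s -> 0 < g v ->
  exists th m, [/\ m \in s, 0 < g m, 0 <= th, t m = th * g m
    & forall w, w \in s -> 0 <= t w - th * g w].
Proof.
move=> t0 vs gv; pose r := [seq w <- s | 0 < g w].
have /(seq_argmin (fun w => t w / g w))[m] : v \in r by rewrite mem_filter gv.
rewrite mem_filter => /andP[gm ms] mP; exists (t m / g m), m.
have th0 : 0 <= t m / g m by rewrite divr_ge0 ?t0 // ltW.
split=> // [|w ws]; first by rewrite divfK // gt_eqF.
case: (ltP 0 (g w)) => gw.
  by rewrite subr_ge0 -ler_pdivlMr // mP // mem_filter gw.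
by rewrite subr_ge0 (le_trans _ (t0 w ws)) // mulr_ge0_le0.
Qed.

Lemma perturb_gt0 (T : eqType) (s : seq T) (f g : T -> R) :
  (forall w, w \in s -> 0 < f w) ->
  exists2 e : R, 0 < e & forall w, w \in s -> 0 < f w + e * g w.
Proof.
elim: s => [|a s IHs] f0; first by exists 1.
have [|e e0 eP] := IHs; first by move=> w ws; apply: f0; rewrite inE ws orbT.
have fa : 0 < f a by apply: f0; exact: mem_head.
(* The step [e'] times the absolute value of [g a] stays below [f a]; the added 1 keeps the
   denominator positive. *)
pose e' := f a / (1 + `|g a|).
have ga : 0 < 1 + `|g a| by rewrite ltr_wpDr.
have e'0 : 0 < e' by rewrite divr_gt0.
have e'a : 0 < f a + e' * g a.
  have -> : f a = e' * (1 + `|g a|) by rewrite divfK // gt_eqF.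
  rewrite -mulrDr mulr_gt0 //; have := ler_norm (- g a); rewrite normrN; lra.
have conv (c r z : R) : 0 < c -> 0 < c + r * z -> 0 < r ->
    forall q, 0 < q <= r -> 0 < c + q * z.
  move=> c0 cr r0 q /andP[q0 qr]; case: (leP 0 z) => z0.
    by rewrite ltr_wpDr // mulr_ge0 // ltW.
  by apply: (lt_le_trans cr); rewrite lerD2l ler_wnM2r // ltW.
exists (Num.min e e'); first by rewrite lt_min e0.
move=> w; rewrite inE => /predU1P[->|ws].
  by apply: (conv _ e') => //; rewrite lt_min e0 e'0 ge_min lexx orbT.
apply: (conv _ e) => //; last by rewrite lt_min e0 e'0 ge_min lexx.
  by apply: f0; rewrite inE ws orbT.
exact: eP.
Qed.

(** Gordan's alternative, by induction on [s]. The hard case is a [w] positive on [s] but negative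
    at [a]: the other vectors are then projected along [y a] into the hyperplane orthogonal to [w],
    and the induction hypothesis is applied to the projections. *)
Lemma gordan (d : nat) (T : eqType) (s : seq T) (y : T -> 'rV[R]_d) : uniq s ->
  (exists w, forall i, i \in s -> 0 < dot w (y i)) \/
  (exists t : T -> R, [/\ forall i, i \in s -> 0 <= t i,
     0 < \sum_(i <- s) t i & \sum_(i <- s) t i *: y i = 0]).
Proof.
elim: s y => [|a s IHs] y /=; first by left; exists 0.
case/andP=> aNs us.
have neq_a i : i \in s -> (i == a) = false.
  by move=> is_; apply: contraNF aNs => /eqP <-.
have extend (c : R) (t : T -> R) : 0 <= c -> (forall i, i \in s -> 0 <= t i) ->
    0 < c + \sum_(i <- s) t i -> c *: y a + \sum_(i <- s) t i *: y i = 0 ->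
    exists t : T -> R, [/\ forall i, i \in a :: s -> 0 <= t i,
     0 < \sum_(i <- a :: s) t i & \sum_(i <- a :: s) t i *: y i = 0].
  move=> c0 t0 ct cty; exists (fun i => if i == a then c else t i); split.
  - by move=> i; rewrite inE; case: (i == a) => //= /t0.
  - rewrite big_cons eqxx big_seq (eq_bigr t) -?big_seq // => i is_.
    by rewrite neq_a.
  - rewrite big_cons eqxx big_seq (eq_bigr (fun i => t i *: y i)) -?big_seq // => i is_.
    by rewrite neq_a.
(* If [w] is positive on [s] and only non-negative at [a], a small move along [y a] makes it
   positive everywhere. *)
have finish w : (forall i, i \in s -> 0 < dot w (y i)) -> 0 <= dot w (y a) ->
    y a != 0 -> exists w, forall i, i \in a :: s -> 0 < dot w (y i).
  move=> ws wa ya.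
  have [e e0 eP] := perturb_gt0 (fun i => dot (y a) (y i)) ws.
  exists (w + e *: y a) => i; rewrite inE dotDl dotZl => /predU1P[->|/eP//].
  by rewrite ltr_wpDl // mulr_gt0 // dot_gt0.
case: (eqVneq (y a) 0) => [ya|ya].
  right; apply: (extend 1 (fun=> 0)) => //; first by rewrite big1 // addr0.
  by rewrite ya scaler0 add0r big1 // => i _; rewrite scale0r.
case: (IHs y us) => [[w ws]|[t [t0 ts ty]]]; last first.
  by right; apply: (extend 0 t) => //; rewrite ?scale0r add0r.
case: (leP 0 (dot w (y a))) => wa; first by left; exact: (finish w).
have wa0 : - dot w (y a) != 0 by rewrite oppr_eq0 lt_eqF.
(* [l i] is chosen so that [y i + l i *: y a] is orthogonal to [w]. *)
pose l i := dot w (y i) / - dot w (y a).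
have l0 i : i \in s -> 0 <= l i.
  by move=> /ws wi; rewrite ltW // divr_gt0 // oppr_gt0.
case: (IHs (fun i => y i + l i *: y a) us) => [[w' w's]|[t [t0 ts ty]]].
  (* Adding [m *: w] makes [w'] vanish at [y a] and keeps on each [y i] the value that [w'] takes on
     its projection. *)
  left; pose m := dot w' (y a) / - dot w (y a).
  apply: (finish (w' + m *: w)) => // [i is_|].
    have := w's i is_; rewrite dotDr dotZr dotDl dotZl.
    suff -> : m * dot w (y i) = l i * dot w' (y a) by [].
    by rewrite /l /m; field; rewrite -oppr_eq0.
  suff -> : dot (w' + m *: w) (y a) = 0 by [].
  by rewrite dotDl dotZl /m; field; rewrite -oppr_eq0.
right; apply: (extend (\sum_(i <- s) t i * l i) t) => //.
- by rewrite big_seq sumr_ge0 // => i is_; rewrite mulr_ge0 ?t0 ?l0.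
- by rewrite ltr_wpDl // big_seq sumr_ge0 // => i is_; rewrite mulr_ge0 ?t0 ?l0.
rewrite -[RHS]ty scaler_suml -big_split; apply: eq_bigr => i _.
by rewrite scalerDr scalerA addrC.
Qed.

End Gordan.

(** * Euclidean balls and compactness of the directions *)

Section Topology.
Local Open Scope ring_scope.
Context {R : realType} {d : nat}.
Implicit Types (u v w x a c : 'rV[R]_d) (A : set 'rV[R]_d).

Lemma sum_mul_continuous (T : topologicalType) (n : nat) (F G : 'I_n -> T -> R) :
  (forall i, continuous (F i)) -> (forall i, continuous (G i)) ->
  continuous (fun y : T => \sum_(i < n) F i y * G i y).
Proof.
move=> cF cG; apply: continuous_big => [|i _ y]; first exact: add_continuous.
by apply: cvgM; [exact: cF|exact: cG].
Qed.

Lemma dot_continuous v : continuous (fun u : 'rV[R]_d => dot u v).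
Proof.
apply: sum_mul_continuous => i; first exact: coord_continuous.
exact: cst_continuous.
Qed.

Lemma dot_square_continuous c : continuous (fun u : 'rV[R]_d => dot (u - c) (u - c)).
Proof.
have cvg_i i : continuous (fun u : 'rV[R]_d => (u - c) ord0 i).
  rewrite (_ : (fun u => _) = (fun u : 'rV[R]_d => u ord0 i - c ord0 i)).
    have sub_cont (T : topologicalType) (f : T -> R) (b : R) :
        continuous f -> continuous (fun y : T => f y - b).
      by move=> cf y; apply: cvgB; [exact: cf|exact: cvg_cst].
    by apply: sub_cont; exact: coord_continuous.
  by apply/funext => u; rewrite !mxE.
exact: sum_mul_continuous.
Qed.

Lemma enorm_le u (r : R) : 0 <= r -> (enorm u <= r) = (dot u u <= r ^+ 2).
Proof. by move=> r0; rewrite -{1}(ger0_norm r0) -sqrtr_sqr ler_sqrt // sqr_ge0. Qed.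

Lemma enorm_eq u (r : R) : 0 <= r -> (enorm u = r) <-> (dot u u = r ^+ 2).
Proof.
move=> r0; rewrite /enorm; split=> [<-|->].
  by rewrite sqr_sqrtr // dot_ge0.
by rewrite sqrtr_sqr ger0_norm.
Qed.

Lemma inside_sphereE c (r : R) a : 0 < r ->
  inside_sphere c r a <-> dot (a - c) (a - c) < r ^+ 2.
Proof.
move=> r0; split; last first.
  move=> ar; have /(continuousP _)/(_ _ (@open_lt _ (r ^+ 2))) := @dot_square_continuous c.
  rewrite openE => /(_ a ar); apply: filterS => b /= /ltW.
  by rewrite /eclosed_ball /= (enorm_le _ (ltW r0)).
rewrite /inside_sphere /interior /= => nb.
have : eclosed_ball c r a by exact: nbhs_singleton nb.
rewrite /eclosed_ball /= (enorm_le _ (ltW r0)) le_eqVlt => /predU1P[ar|//].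
move/nbhs_ballP: nb => [e /= e0 eP].
(* [s] bounds every coordinate of [a - c], so pushing the boundary point [a] outwards by the factor
   [1 + e / 2 / s] stays in the sup-norm ball around [a] but leaves the Euclidean ball. *)
pose s := 1 + \sum_(i < d) `|(a - c) ord0 i|.
have s0 : 0 < s by rewrite ltr_wpDr // sumr_ge0.
have es : 0 < e / 2 / s by rewrite !divr_gt0.
have /eP : ball a e (a + (e / 2 / s) *: (a - c)).
  split=> // i j; rewrite (ord1 i) -ball_normE /ball_ /= mxE opprD addrA subrr sub0r normrN.
  rewrite mxE normrM gtr0_norm //.
  have : `|(a - c) ord0 j| <= s.
    rewrite /s (bigD1 j) //= addrCA lerDl addr_ge0 // sumr_ge0 //.
  move=> /(ler_wpM2l (ltW es)) /le_lt_trans; apply.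
  by rewrite divfK ?gt_eqF //; lra.
rewrite /eclosed_ball /= (enorm_le _ (ltW r0)) addrAC -{1 3}[a - c]scale1r -scalerDl.
rewrite dotZl dotZr ar => le1.
have r20 : 0 < r ^+ 2 by rewrite exprn_gt0.
nra.
Qed.

Definition surrounds (F : {fset 'rV[R]_d}) x :=
  forall u, dot u u = 1 -> exists2 a, a \in F & dot u (a - x) < - 2^-1.

(* The half-spaces at signed distance [-1] from [x] in all directions each
   contain a point of [A]; by compactness of the unit sphere finitely many of
   these points witness the slightly weaker bound [-1/2]. *)
Lemma finite_surrounding A x : coarsely_dense A ->
  exists2 F : {fset 'rV[R]_d}, [set` F] `<=` A & surrounds F x.
Proof.
move=> cA; pose S : set 'rV[R]_d := [set u | dot (u - 0) (u - 0) = 1].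
have cS : compact S.
  have cB : compact [set v : 'rV[R]_d | forall i, `[-1, 1]%classic (v ord0 i)].
    exact: (@rV_compact R d (fun=> `[-1, 1]%classic)) (fun=> @segment_compact _ _ _).
  apply: (subclosed_compact _ cB).
  - have /continuous_closedP/(_ [set 1]) := @dot_square_continuous 0.
    by apply; exact: closed_eq.
  - move=> u; rewrite /S /= subr0 /dot => u1 i; rewrite /= in_itv /= -ler_norml.
    rewrite -(@expr_le1 _ 2) // real_normK ?num_real // -u1 (bigD1 i) //= -expr2 lerDl.
    by rewrite sumr_ge0 // => j _; rewrite -expr2 sqr_ge0.
move: cS; rewrite compact_cover => /(_ _ A (fun a => [set u | dot u (a - x) < - 2^-1])).
case.
- move=> a _; have /continuousP/(_ _ (@open_lt _ (- 2^-1))) := @dot_continuous (a - x).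
  exact.
- move=> u; rewrite /S /= subr0 => u1.
  have [|a [Aa]] := cA u (dot u x - 1).
    by apply: contra_eqN u1 => /eqP ->; rewrite dotr0 eq_sym oner_eq0.
  by rewrite /closed_halfspace /= => ha; exists a => //=; rewrite dotDr dotNr; lra.
move=> F FA cF; exists F; first by move=> a /= /FA; rewrite inE.
move=> u u1; have /cF[a /= aF] : S u by rewrite /S /= subr0.
by exists a.
Qed.

End Topology.

(** * Powers of points, genericity and uniqueness of the empty simplex *)

Section Delaunay.
Local Open Scope ring_scope.
Context {R : realType} {d : nat}.
Implicit Types (u v w x a c : 'rV[R]_d) (A : set 'rV[R]_d).
Implicit Types (U V W B F : {fset 'rV[R]_d}).

(* The power of [a] with respect to the sphere of centre [c := x + u / 2] and
   squared radius [h + dot u u / 4]; thus [h] is minus the power of [x]. *)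
Definition power x u (h : R) a : R := dot (a - x) (a - x) - dot u (a - x) - h.

(** The level [- m - 1] lies below [b] and below all values of [dot u] on [B], so the point found
    there is outside [B]. *)
Lemma coarsely_denseD A B : coarsely_dense A -> coarsely_dense (A `\` [set` B]).
Proof.
move=> cA u b u0; pose m := `|b| + \sum_(a <- B) `|dot u a|.
have [a [Aa]] := cA u (- m - 1) u0; rewrite /closed_halfspace /= => ua.
have m0 : 0 <= \sum_(a <- B) `|dot u a| by rewrite sumr_ge0.
exists a; split; last first.
  by rewrite /closed_halfspace /=; have := ler_norm (- b); rewrite normrN /m in ua *; lra.
split=> //= aB.
have : `|dot u a| <= m.
  by rewrite /m (big_fsetD1 a) //= addrCA lerDl addr_ge0 // sumr_ge0.
by have := ler_norm (- dot u a); rewrite normrN; lra.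
Qed.

Lemma locally_finiteD A B : locally_finite A -> locally_finite (A `\` [set` B]).
Proof. by move=> fA c r; apply: sub_finite_set (fA c r) => a [[]]. Qed.

Lemma genericW A A' : A `<=` A' -> generic A' -> generic A.
Proof.
by move=> AB [g1 g2]; split=> V VA; [apply: g1|apply: g2]; exact: subset_trans VA AB.
Qed.

Lemma generic_wrtW A A' x : A `<=` A' -> generic_wrt A' x -> generic_wrt A x.
Proof.
move=> AB [Bx gB]; split; first by move/AB.
by apply: genericW gB => a [->|/AB]; [left|right].
Qed.

Lemma conv_dot x V (t : 'rV[R]_d -> R) u :
  \sum_(v <- V) t v = 1 -> x = \sum_(v <- V) t v *: v ->
  \sum_(v <- V) t v * dot u (v - x) = 0.
Proof.
move=> t1 xE; under eq_bigr => v _ do rewrite dotDr mulrDr -dotZr.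
by rewrite big_split /= -dot_sumr -xE -mulr_suml t1 mul1r dotNr subrr.
Qed.

(** The linear part of [power] averages to zero because [x] is the barycentre; what remains is the
    objective of the linear programme minus [h]. *)
Lemma conv_power x V (t : 'rV[R]_d -> R) u h :
  \sum_(v <- V) t v = 1 -> x = \sum_(v <- V) t v *: v ->
  \sum_(v <- V) t v * power x u h v =
  \sum_(v <- V) t v * dot (v - x) (v - x) - h.
Proof.
move=> t1 xE; under eq_bigr => v _ do rewrite !mulrDr !mulrN.
by rewrite !big_split /= !sumrN (conv_dot _ t1 xE) -mulr_suml t1 mul1r oppr0 addr0.
Qed.

Lemma conv_height x V (t : 'rV[R]_d -> R) u h :
  \sum_(v <- V) t v = 1 -> x = \sum_(v <- V) t v *: v ->
  (forall v, v \in V -> power x u h v = 0) ->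
  \sum_(v <- V) t v * dot (v - x) (v - x) = h.
Proof.
move=> t1 xE pV; apply/eqP; rewrite -subr_eq0 -(conv_power u h t1 xE).
by rewrite big_seq big1 // => v /pV ->; rewrite mulr0.
Qed.

Lemma power_sphere x u h a :
  dot (a - (x + 2^-1 *: u)) (a - (x + 2^-1 *: u)) =
  power x u h a + (h + dot u u / 4).
Proof.
rewrite /power opprD addrA; move: (a - x) => y.
by rewrite !dotE (dotC y u); field.
Qed.

Lemma exists_circumsphere x V : #|` V| = d.+1 -> ~ on_common_hyperplane V ->
  exists u h, forall v, v \in V -> power x u h v = 0.
Proof.
move=> cV nV.
have [u [h uh]] := affine_interpolation x (fun v => dot (v - x) (v - x)) cV nV.
by exists u, h => v /uh; rewrite /power => <-; ring.
Qed.

Lemma circumsphere_unique x V u h u' h' : #|` V| = d.+1 -> ~ on_common_hyperplane V ->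
  (forall v, v \in V -> power x u h v = 0) ->
  (forall v, v \in V -> power x u' h' v = 0) -> u = u' /\ h = h'.
Proof.
move=> cV nV pV pV'.
have [|/eqP + /eqP] := @affine_vanish _ _ x V (u - u') (h - h') cV nV.
  by move=> v vV; move: (pV v vV) (pV' v vV); rewrite /power (dotDl u) (dotNl u'); lra.
by rewrite !subr_eq0 => /eqP-> /eqP->.
Qed.

Lemma const1_neq0 : (0 < d)%N -> const_mx 1 != 0 :> 'rV[R]_d.
Proof.
move=> d0; apply/eqP => /rowP/(_ (Ordinal d0)).
by rewrite !mxE; exact/eqP/oner_neq0.
Qed.

(** Coarse density survives the removal of a finite set, so new points are always available. Such
    padding is needed because genericity only speaks of sets of exact size. *)
Lemma fset_extend A V n : (0 < d)%N -> coarsely_dense A ->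
  [set` V] `<=` A -> (#|` V| <= n)%N ->
  exists U, [/\ (V `<=` U)%fset, [set` U] `<=` A & #|` U| = n].
Proof.
move=> d0 cA VA /subnK <-; elim: (n - _)%N => [|m [U [VU UA cU]]].
  by exists V; rewrite fsubset_refl.
have [a [[Aa /= aU] _]] := coarsely_denseD U cA 0 (const1_neq0 d0).
exists (a |` U)%fset; split.
- exact: fsubset_trans VU (fsubsetU1 _ _).
- by move=> v /=; rewrite in_fset1U => /predU1P[->//|/UA].
- by rewrite cardfsU1 cU; move/negP: aU => ->; rewrite addSn.
Qed.

Section FixedPoint.
Variables (A : set 'rV[R]_d) (x : 'rV[R]_d).
Hypotheses (d0 : (0 < d)%N) (cA : coarsely_dense A) (gA : generic A).
Hypothesis gx : generic_wrt A x.

(** After padding [U] to [d] points, a convex combination equal to [x] would be an affine dependency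
    among [d + 1] points of the generic set formed by [A] and [x]. *)
Lemma generic_not_conv U : [set` U] `<=` A -> (#|` U| <= d)%N -> ~ conv_hull U x.
Proof.
move=> UA cU [t [t0 t1 xE]].
have [V [UV VA cV]] := fset_extend d0 cA UA cU.
have xV : x \notin V by apply/negP => /VA; exact: gx.1.
have cxV : #|` (x |` V)%fset| = d.+1 by rewrite cardfsU1 xV cV.
have nxV : ~ on_common_hyperplane (x |` V)%fset.
  apply: gx.2.1 => // v /=; rewrite in_fset1U => /predU1P[->|/VA]; first by left.
  by right.
pose s v : R := if v == x then -1 else if v \in U then t v else 0.
have sumV (Z : lmodType R) (f : 'rV[R]_d -> Z) :
    \sum_(v <- (x |` V)%fset) s v *: f v = \sum_(v <- U) t v *: f v - f x.
  rewrite big_fsetU1 //= {1}/s eqxx scaleN1r addrC; congr (_ - _).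
  rewrite -(@big_fset_incl _ _ _ _ _ _ (fun v => s v *: f v) UV); last first.
    move=> v vV vU; rewrite /s (negbTE vU) ifN ?scale0r //.
    by apply: contraNneq xV => <-.
  rewrite big_seq [RHS]big_seq; apply: eq_bigr => v vU; rewrite /s vU ifN //.
  by apply: contraNneq xV => <-; exact: (fsubsetP UV).
have s0 : \sum_(v <- (x |` V)%fset) s v = 0.
  have := sumV R^o (fun=> 1); rewrite -!scaler_suml t1 scale1r subrr.
  by rewrite /GRing.scale /= mulr1.
have sv0 : \sum_(v <- (x |` V)%fset) s v *: v = 0 by rewrite (sumV _ id) -xE subrr.
have /eqP := affine_independence cxV nxV s0 sv0 (fset1U1 x V); rewrite /s eqxx.
by rewrite oppr_eq0 oner_eq0.
Qed.

(** A vertex of weight zero could be dropped, leaving [x] in the hull of [d] points. *)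
Lemma generic_conv_gt0 V (t : 'rV[R]_d -> R) :
  [set` V] `<=` A -> #|` V| = d.+1 -> (forall v, v \in V -> 0 <= t v) ->
  \sum_(v <- V) t v = 1 -> x = \sum_(v <- V) t v *: v ->
  forall v, v \in V -> 0 < t v.
Proof.
move=> VA cV t0 t1 xE v vV; rewrite lt_def t0 // andbT; apply/eqP => tv.
apply: (@generic_not_conv (V `\ v)%fset).
- by move=> w /=; rewrite in_fsetD1 => /andP[_ /VA].
- by have := cardfsD1 v V; rewrite vV cV; lia.
exists t; split.
- by move=> w; rewrite in_fsetD1 => /andP[_ /t0].
- by rewrite -t1 [RHS](big_fsetD1 v) //= tv add0r.
- by rewrite xE [LHS](big_fsetD1 v) //= tv scale0r add0r.
Qed.

(** The height is a weighted mean of squared distances from [x] to points of [A], none of which is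
    [x]. It is used to see that squared radii are positive. *)
Lemma conv_height_gt0 V u h : [set` V] `<=` A -> #|` V| = d.+1 ->
  conv_hull V x -> (forall v, v \in V -> power x u h v = 0) -> 0 < h.
Proof.
move=> VA cV [t [t0 t1 xE]] pV; rewrite -(conv_height t1 xE pV).
case: (fset_0Vmem V) => [V0|[v vV]]; first by move: cV; rewrite V0 cardfs0.
rewrite (big_fsetD1 v) //= ltr_wpDr //.
  rewrite big_seq sumr_ge0 // => w; rewrite in_fsetD1 => /andP[_ wV].
  by rewrite mulr_ge0 ?t0 ?dot_ge0.
rewrite mulr_gt0 ?(generic_conv_gt0 VA cV t0 t1 xE) // dot_gt0 subr_eq0.
by apply: contra_notN gx.1 => /eqP <-; exact: VA.
Qed.

(* Strong duality of the linear programme minimising the convex combination of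
   [dot (v - x) (v - x)]: the two simplices have the same value [h]. *)
Lemma empty_simplex_unique V V' u h u' h' :
  [set` V] `<=` A -> [set` V'] `<=` A -> #|` V| = d.+1 -> #|` V'| = d.+1 ->
  conv_hull V x -> conv_hull V' x ->
  (forall v, v \in V -> power x u h v = 0) ->
  (forall v, v \in V' -> power x u' h' v = 0) ->
  (forall a, A a -> 0 <= power x u h a) -> (forall a, A a -> 0 <= power x u' h' a) ->
  V = V'.
Proof.
move=> VA VA' cV cV' [t [t0 t1 xE]] [t' [t0' t1' xE']] pV pV' pA pA'.
have hE := conv_height t1 xE pV; have hE' := conv_height t1' xE' pV'.
have h'h : h' <= h.
  rewrite -subr_ge0 -hE -(conv_power u' h' t1 xE) big_seq sumr_ge0 // => v vV.
  by rewrite mulr_ge0 ?t0 // pA' //; exact: VA.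
have hh' : h <= h'.
  rewrite -subr_ge0 -hE' -(conv_power u h t1' xE') big_seq sumr_ge0 // => v vV.
  by rewrite mulr_ge0 ?t0' // pA //; exact: VA'.
have {hh' h'h} eh : h = h' by apply/eqP; rewrite eq_le hh' h'h.
(* Complementary slackness: non-negative powers with positive weights average to zero, so each of
   them is zero. *)
have pV'V v : v \in V -> power x u' h' v = 0.
  move=> vV; have : \sum_(v <- V) t v * power x u' h' v = 0.
    by rewrite (conv_power u' h' t1 xE) hE eh subrr.
  rewrite (big_fsetD1 v) //= => /eqP; rewrite paddr_eq0 ?mulr_ge0 ?t0 ?pA' //; last 2 first.
  - exact: VA.
  - rewrite big_seq sumr_ge0 // => w; rewrite in_fsetD1 => /andP[_ wV].
    by rewrite mulr_ge0 ?t0 // pA' //; exact: VA.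
  by rewrite mulf_eq0 gt_eqF ?(generic_conv_gt0 VA cV t0 t1 xE) //= => /andP[/eqP].
(* A vertex of [V] outside [V'] would be one more point of [A] on the circumscribed sphere of [V'],
   giving [d + 2] cospherical points. *)
have sVV' : (V `<=` V')%fset.
  apply/fsubsetP => v vV; apply: contraPT isT => vV' _.
  apply: (gA.2 (v |` V')%fset).
  - by move=> w /=; rewrite in_fset1U => /predU1P[->|/VA'//]; exact: VA.
  - by rewrite cardfsU1 vV' cV'.
  have r0 : 0 < h' + dot u' u' / 4.
    rewrite ltr_wpDr ?divr_ge0 ?dot_ge0 //.
    exact: (conv_height_gt0 VA' cV' (ex_intro _ t' (And3 t0' t1' xE')) pV').
  exists (x + 2^-1 *: u'), (Num.sqrt (h' + dot u' u' / 4)).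
  rewrite sqrtr_gt0; split=> // w /= wV; rewrite /esphere /= /enorm (power_sphere _ _ h').
  by move: wV; rewrite in_fset1U => /predU1P[->|/pV' ->]; rewrite ?pV'V // add0r.
by apply/eqP; rewrite eqEfcard sVV' cV cV' leqnn.
Qed.

End FixedPoint.
End Delaunay.

(** * Pivoting, bounded windows and existence of the empty simplex *)

Section Existence.
Local Open Scope ring_scope.
Context {R : realType} {d : nat}.
Implicit Types (u v w x a c : 'rV[R]_d) (A : set 'rV[R]_d).
Implicit Types (U V W B F : {fset 'rV[R]_d}).

(** The pivot of the simplex method: [a] enters and some [w] in [V] leaves. Since [s] sums to 1,
    some entry is positive and the ratio test applies; [a] has direction [-1] and so cannot be the
    one to leave. Stating the effect for all [f] covers weight, barycentre and objective at once. *)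
Lemma exchange U V a (t s : 'rV[R]_d -> R) :
  \sum_(v <- V) s v = 1 -> a \notin V -> (a |` V `<=` U)%fset ->
  (forall v, v \in U -> 0 <= t v) ->
  exists w th (t' : 'rV[R]_d -> R),
    [/\ w \in V, t w = th * s w & 0 <= th] /\
    [/\ forall v, v \in U -> 0 <= t' v, t' w = 0
      & forall (Z : lmodType R) (f : 'rV[R]_d -> Z),
          \sum_(v <- U) t' v *: f v =
          \sum_(v <- U) t v *: f v - th *: (\sum_(v <- V) s v *: f v - f a)].
Proof.
move=> s1 aV aVU t0.
pose g v : R := if v == a then -1 else if v \in V then s v else 0.
have gV v : v \in V -> g v = s v.
  by move=> vV; rewrite /g vV ifN //; apply: contraNneq aV => <-.
have [p pV sp] : exists2 v, v \in V & 0 < s v.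
  apply: contrapT => nex; suff : \sum_(v <- V) s v <= 0 by rewrite s1 ler10.
  rewrite big_seq sumr_le0 // => v vV; rewrite leNgt; apply/negP => sv.
  by apply: nex; exists v.
have VU v : v \in V -> v \in U.
  by move=> vV; apply: (fsubsetP aVU); rewrite in_fset1U vV orbT.
have gp : 0 < g p by rewrite gV.
have [th [w [wU gw th0 tw tU]]] := ratio_test t0 (VU _ pV) gp.
have wV : w \in V.
  by move: gw; rewrite /g; case: eqP => [_|_]; [lra|case: ifP => //; rewrite ltxx].
exists w, th, (fun v => t v - th * g v); split; first by rewrite -gV.
split=> // [|Z f]; first by rewrite tw subrr.
have -> : \sum_(v <- V) s v *: f v - f a = \sum_(v <- U) g v *: f v.
  rewrite -(big_fset_incl _ aVU); last first.
    move=> v _; rewrite in_fset1U negb_or => /andP[va vV].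
    by rewrite /g (negbTE va) (negbTE vV) scale0r.
  rewrite big_fsetU1 //= {1}/g eqxx scaleN1r addrC; congr (_ - _).
  by rewrite big_seq [RHS]big_seq; apply: eq_bigr => v vV; rewrite gV.
rewrite scaler_sumr -sumrB; apply: eq_bigr => v _.
by rewrite scalerBl scalerA.
Qed.

Lemma conv_exchange x U V a (t s : 'rV[R]_d -> R) :
  \sum_(v <- V) s v = 1 -> \sum_(v <- V) s v *: v = a ->
  a \notin V -> (a |` V `<=` U)%fset ->
  (forall v, v \in U -> 0 <= t v) -> \sum_(v <- U) t v = 1 ->
  x = \sum_(v <- U) t v *: v ->
  exists w th (t' : 'rV[R]_d -> R),
    [/\ w \in V, t w = th * s w & 0 <= th] /\
    [/\ forall v, v \in (U `\ w)%fset -> 0 <= t' v,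
        \sum_(v <- (U `\ w)%fset) t' v = 1, x = \sum_(v <- (U `\ w)%fset) t' v *: v
      & forall f : 'rV[R]_d -> R,
          \sum_(v <- (U `\ w)%fset) t' v * f v =
          \sum_(v <- U) t v * f v - th * (\sum_(v <- V) s v * f v - f a)].
Proof.
move=> s1 sa aV aVU t0 t1 xE.
have [w [th [t' [[wV tw th0] [t'0 t'w tU]]]]] := exchange s1 aV aVU t0.
have wU : w \in U by apply: (fsubsetP aVU); rewrite in_fset1U wV orbT.
have sumD (Z : lmodType R) (f : 'rV[R]_d -> Z) :
    \sum_(v <- (U `\ w)%fset) t' v *: f v = \sum_(v <- U) t' v *: f v.
  by rewrite [RHS](big_fsetD1 w) //= t'w scale0r add0r.
exists w, th, t'; split=> //; split.
- by move=> v; rewrite in_fsetD1 => /andP[_ /t'0].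
- have := sumD R^o (fun=> 1); rewrite tU -!scaler_suml t1 s1 scale1r subrr scaler0 subr0.
  by rewrite /GRing.scale /= mulr1.
- by rewrite (sumD _ id) tU /= sa subrr scaler0 subr0.
- by move=> f; have := sumD R^o f; rewrite tU.
Qed.

(** As long as there are more than [d + 1] points, pivoting in one outside a chosen [d + 1] of them
    removes a point. Genericity rules out ending with fewer. *)
Lemma caratheodory A x U : (0 < d)%N -> coarsely_dense A -> generic A ->
  generic_wrt A x -> [set` U] `<=` A -> conv_hull U x ->
  exists V, [/\ (V `<=` U)%fset, #|` V| = d.+1 & conv_hull V x].
Proof.
move=> d0 cA gA gx; move: {2}#|` U| (leqnn #|` U|) => n.
elim: n U => [|n IHn] U cU UA xU.
  by case: (generic_not_conv d0 cA gx UA _ xU); exact: leq_trans cU _.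
case: (ltngtP #|` U| d.+1) => [|ltdU|cUd].
- by rewrite ltnS => /(generic_not_conv d0 cA gx UA) /(_ xU).
- have [V VU cV] : exists2 V, (V `<=` U)%fset & #|` V| = d.+1.
    exists [fset v in take d.+1 U]%fset.
      by apply/fsubsetP => v; rewrite !inE => /mem_take.
    rewrite card_fseq undup_id ?take_uniq ?fset_uniq // size_takel //.
    exact: ltnW.
  have [a /[!in_fsetD] /andP[aV aU]] : exists a, a \in (U `\` V)%fset.
    apply/fset0Pn; rewrite -cardfs_gt0 cardfsDS // subn_gt0 cV //.
  have VA : [set` V] `<=` A by move=> v /= /(fsubsetP VU)/UA.
  have [s [s1 sa]] := barycentric a cV (gA.1 V VA cV).
  have aVU : (a |` V `<=` U)%fset by rewrite fsubUset fsub1set aU.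
  have [t [t0 t1 xE]] := xU.
  have [w [th [t' [[wV _ _] [t'0 t'1 xE' _]]]]] := conv_exchange s1 sa aV aVU t0 t1 xE.
  have wU := fsubsetP VU _ wV.
  have [|||V' [V'U cV' xV']] := IHn (U `\ w)%fset.
  + by move: cU; rewrite (cardfsD1 w) wU.
  + by move=> v /=; rewrite in_fsetD1 => /andP[_ /UA].
  + by exists t'.
  by exists V'; split=> //; apply: fsubset_trans V'U (fsubD1set _ _).
- by exists U; rewrite fsubset_refl.
Qed.

(** By Gordan's alternative: a direction in which all of [F] lies strictly ahead of [x] contradicts
    surrounding, and otherwise the dependency is normalised to total weight 1. *)
Lemma surrounds_conv F x : (0 < d)%N -> surrounds F x -> conv_hull F x.
Proof.
move=> d0 sF.
have surr u : u != 0 -> exists2 a, a \in F & dot u (a - x) <= - (enorm u / 2).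
  move=> u0; have nu : 0 < enorm u by rewrite sqrtr_gt0 dot_gt0.
  have [|a aF] := sF ((enorm u)^-1 *: u).
    have uu : dot u u = enorm u ^+ 2 by rewrite sqr_sqrtr // dot_ge0.
    by rewrite dotZl dotZr uu; field; rewrite gt_eqF.
  rewrite dotZl => /ltW; rewrite mulrC ler_pdivrMr // => ua; exists a => //; lra.
have [[w wF]|[t [t0 ts tE]]] := gordan (fun a => a - x) (fset_uniq F).
  have [w0|/surr[a /wF wa wa']] := eqVneq w 0; last first.
    have : 0 <= enorm w / 2 by rewrite divr_ge0 ?sqrtr_ge0.
    lra.
  by have [a /wF] := surr _ (const1_neq0 d0); rewrite w0 dot0l ltxx.
pose T := \sum_(v <- F) t v; have T0 : T != 0 by rewrite gt_eqF.
exists (fun v => t v / T); split.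
- by move=> v /t0 tv; rewrite divr_ge0 // ltW.
- by rewrite -mulr_suml divff.
move: tE; under eq_bigr => v _ do rewrite scalerBr.
rewrite sumrB -scaler_suml -/T => /eqP; rewrite subr_eq0 => /eqP tE.
under eq_bigr => v _ do rewrite mulrC -scalerA.
by rewrite -scaler_sumr tE scalerA mulVf // scale1r.
Qed.

(** Some [a] in [F] lies more than [1 / 2] ahead of [x] in the direction of [u]. As its power is
    non-negative, its squared distance, at most [M], dominates [enorm u / 2 + h], which bounds the
    sphere. *)
Lemma surrounds_bound F x : (0 < d)%N -> surrounds F x ->
  exists rho : R, forall u h, 0 <= h -> (forall a, a \in F -> 0 <= power x u h a) ->
    forall p, power x u h p <= 0 -> eclosed_ball x rho p.
Proof.
move=> d0 sF.
pose M := \sum_(a <- F) dot (a - x) (a - x).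
have M0 : 0 <= M by rewrite sumr_ge0 // => a _; exact: dot_ge0.
have leM a : a \in F -> dot (a - x) (a - x) <= M.
  move=> aF; rewrite /M (big_fsetD1 a) //= lerDl sumr_ge0 // => b _; exact: dot_ge0.
(* For [y = p - x], the bounds on [u] and [h] and the square of [u - y / 2] give
   [dot y y <= 8 * M ^+ 2 + 2 * M]; the summand 1 makes [rho] at most its square. *)
exists (1 + 8 * M ^+ 2 + 2 * M) => u h h0 pF p pp.
have [uM hM] : dot u u <= 4 * M ^+ 2 /\ h <= M.
  have [u0|u0] := eqVneq u 0.
    split; first by rewrite u0 dotr0 mulr_ge0 // sqr_ge0.
    have [t [t0 t1 _]] := surrounds_conv d0 sF.
    case: (fset_0Vmem F) => [F0|[a aF]].
      by move: t1; rewrite F0 big_seq_fset0 => /eqP; rewrite eq_sym oner_eq0.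
    by have := pF a aF; have := leM a aF; rewrite /power u0 dot0l; lra.
  have nu : 0 < enorm u by rewrite sqrtr_gt0 dot_gt0.
  have uu : dot u u = enorm u ^+ 2 by rewrite sqr_sqrtr // dot_ge0.
  have [|a aF] := sF (- ((enorm u)^-1 *: u)).
    by rewrite dotNl dotNr opprK dotZl dotZr uu; field; rewrite gt_eqF.
  rewrite dotNl ltrN2 dotZl mulrC ltr_pdivlMr // => ua.
  have := pF a aF; have := leM a aF; rewrite /power uu => h1 h2.
  by split; [nra|lra].
have : 0 <= dot (u - 2^-1 *: (p - x)) (u - 2^-1 *: (p - x)) by exact: dot_ge0.
move: pp; rewrite /power /eclosed_ball /=; move: (p - x) => y.
rewrite enorm_le; last by rewrite !addr_ge0 ?mulr_ge0 ?sqr_ge0.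
rewrite !dotE (dotC y u) => h1 h2; nra.
Qed.

(* Induction on [K]: a sphere either avoids the surrounding set [F], or one of
   its at most [K] inner points is in [F], and then [A `\` F] has fewer. *)
Lemma window_bound A x K : (0 < d)%N -> coarsely_dense A ->
  exists rho : R, forall B u h, (#|` B| <= K)%N -> 0 <= h ->
    (forall a, A a -> power x u h a < 0 -> a \in B) ->
    forall p, power x u h p <= 0 -> eclosed_ball x rho p.
Proof.
move=> d0; elim: K A => [|K IHK] A cA;
  have [F FA /(surrounds_bound d0)[rho rhoP]] := finite_surrounding x cA.
  exists rho => B u h; rewrite leqn0 cardfs_eq0 => /eqP -> h0 hB.
  apply: rhoP => // a aF; rewrite leNgt; apply/negP => /(hB _ (FA _ aF)).
  by rewrite in_fset0.
have [rho' rho'P] := IHK _ (coarsely_denseD F cA).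
exists (Num.max rho rho') => B u h cB h0 hB p pp.
have [pF|] := pselect (forall a, a \in F -> 0 <= power x u h a).
  by have := rhoP _ _ h0 pF p pp; rewrite /eclosed_ball /= le_max => ->.
move=> /existsNP[a /not_implyP[aF /negP]]; rewrite -ltNge => pa.
have aB : a \in B by apply: hB => //; exact: FA.
have : eclosed_ball x rho' p.
  apply: (rho'P (B `\` F)%fset u h) => //.
    have /fsubset_leq_card : (B `\` F `<=` B `\ a)%fset.
      by apply: fsetDS; rewrite fsub1set.
    by move: cB; rewrite (cardfsD1 a B) aB; lia.
  move=> b [Ab /= /negP bF] pb; rewrite in_fsetD bF /=; exact: hB.
by rewrite /eclosed_ball /= le_max => ->; rewrite orbT.
Qed.

(** Among the finitely many simplices around [x] with vertices in [W], take one of least height. A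
    point of [W] inside its sphere could be pivoted in to lower the height. As [W] contains the
    surrounding set [F], the sphere is bounded, and every point of [A] inside it is in [W]. *)
Lemma empty_simplex_exists A x : (0 < d)%N -> thin_Delone A -> generic A ->
  generic_wrt A x ->
  exists V u h, [/\ [set` V] `<=` A, #|` V| = d.+1, conv_hull V x,
    forall v, v \in V -> power x u h v = 0 & forall a, A a -> 0 <= power x u h a].
Proof.
move=> d0 [fA cA] gA gx.
have [F FA sF] := finite_surrounding x cA.
have [rho rhoP] := surrounds_bound d0 sF.
have fW := fA x rho.
pose W := (F `|` fset_set (A `&` eclosed_ball x rho))%fset.
have WA : [set` W] `<=` A.
  by move=> a /=; rewrite in_fsetU in_fset_set // => /orP[/FA|/set_mem[]].
pose good V := [/\ [set` V] `<=` A, #|` V| = d.+1 & conv_hull V x].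
pose height V := xget 0 [set h | exists u, forall v, v \in V -> power x u h v = 0].
have heightP V : good V -> exists u, forall v, v \in V -> power x u (height V) v = 0.
  case=> VA cV xV; have [u [h uh]] := exists_circumsphere x cV (gA.1 _ VA cV).
  by apply: (xgetPex 0 (P := [set h | exists u, forall v, v \in V -> power x u h v = 0]));
    exists h, u.
have [V0 [V0F cV0 xV0]] := caratheodory d0 cA gA gx FA (surrounds_conv d0 sF).
pose S := [seq V <- fpowerset W | `[< good V >]].
have inS V : (V `<=` W)%fset -> good V -> V \in S.
  by move=> VW gV; rewrite mem_filter fpowersetE VW andbT; apply/asboolP.
have [|V] := seq_argmin height (s := S) (v := V0).
  apply: inS; first exact: fsubset_trans V0F (fsubsetUl _ _).
  by split=> // v /= /(fsubsetP V0F)/FA.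
rewrite mem_filter fpowersetE => /andP[/asboolP gV VW] minV.
have [u uV] := heightP V gV; have [VA cV xV] := gV.
exists V, u, (height V).
have h0 := conv_height_gt0 d0 cA gx VA cV xV uV.
have pW a : a \in W -> 0 <= power x u (height V) a.
  move=> aW; rewrite leNgt; apply/negP => pa.
  have aV : a \notin V by apply: contraTN pa => /uV ->; rewrite ltxx.
  have [s [s1 sa]] := barycentric a cV (gA.1 V VA cV).
  have [t [t0 t1 xE]] := xV.
  (* The entering point [a] starts with weight 0. *)
  pose t2 v := if v == a then 0 else t v.
  have t2V v : v \in V -> t2 v = t v.
    by move=> vV; rewrite /t2 ifN //; apply: contraNneq aV => <-.
  have sumV (Z : lmodType R) (f : 'rV[R]_d -> Z) :
      \sum_(v <- (a |` V)%fset) t2 v *: f v = \sum_(v <- V) t v *: f v.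
    rewrite big_fsetU1 //= {1}/t2 eqxx scale0r add0r.
    by rewrite big_seq [RHS]big_seq; apply: eq_bigr => v vV; rewrite t2V.
  have [||||w [th [t' [[wV tw th0] [t'0 t'1 xE' t'f]]]]] :=
    @conv_exchange x (a |` V)%fset V a t2 s s1 sa aV.
  + exact: fsubset_refl.
  + by move=> v; rewrite in_fset1U /t2; case: eqP => //= _ /t0.
  + by have := sumV R^o (fun=> 1); rewrite -!scaler_suml t1 /GRing.scale /= !mulr1.
  + by rewrite (sumV _ id).
  have th_gt0 : 0 < th.
    rewrite lt_def th0 andbT; apply: contra_eqN tw => /eqP ->.
    by rewrite mul0r t2V // gt_eqF // (generic_conv_gt0 d0 cA gx VA cV t0 t1 xE).
  have aVA : [set` (a |` V)%fset] `<=` A.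
    by move=> v /=; rewrite in_fset1U => /predU1P[->|/VA//]; exact: WA.
  have gV' : good ((a |` V) `\ w)%fset.
    split; last by exists t'.
      by move=> v /=; rewrite in_fsetD1 => /andP[_ /aVA].
    have := cardfsD1 w (a |` V)%fset; rewrite cardfsU1 aV cV in_fset1U wV orbT; lia.
  have [u' u'V] := heightP _ gV'.
  (* The new height is the old one plus [th] times the negative power of [a], against minimality. *)
  have := conv_power u (height V) t'1 xE'.
  rewrite (conv_height t'1 xE' u'V) t'f.
  have pV0 (r : 'rV[R]_d -> R) : \sum_(v <- V) r v * power x u (height V) v = 0.
    by rewrite big_seq big1 // => v /uV ->; rewrite mulr0.
  rewrite pV0 (_ : \sum_(v <- _) t2 v * _ = 0); last first.
    exact: etrans (sumV R^o _) (pV0 t).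
  have : height V <= height ((a |` V) `\ w)%fset.
    apply: minV; apply: inS => //; apply/fsubsetP => v; rewrite in_fsetD1 in_fset1U.
    by move=> /andP[_ /predU1P[->//|]]; exact: (fsubsetP VW).
  nra.
split=> // a Aa; rewrite leNgt; apply/negP => pa.
have : a \in W.
  rewrite in_fsetU in_fset_set // mem_set ?orbT //; split=> //.
  apply: (rhoP u (height V)); rewrite ?ltW // => b bF.
  by apply: pW; rewrite in_fsetU bF.
by move/pW; rewrite leNgt pa.
Qed.

End Existence.

(** * A simplex determines its vertices *)

Section ConvexHull.
Local Open Scope ring_scope.
Context {R : realType} {d : nat}.
Implicit Types (u v w p : 'rV[R]_d) (V : {fset 'rV[R]_d}).

Lemma conv_hull_vertex V v : v \in V -> conv_hull V v.
Proof.
move=> vV; exists (fun w => (w == v)%:R); split; first by move=> w _; rewrite ler0n.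
  rewrite (big_fsetD1 v) //= eqxx big_seq big1 ?addr0 // => w.
  by rewrite in_fsetD1 => /andP[/negbTE ->].
rewrite (big_fsetD1 v) //= eqxx scale1r big_seq big1 ?addr0 // => w.
by rewrite in_fsetD1 => /andP[/negbTE ->]; rewrite scale0r.
Qed.

Lemma conv_affine V p (t : 'rV[R]_d -> R) u h :
  \sum_(v <- V) t v = 1 -> p = \sum_(v <- V) t v *: v ->
  dot u p + h = \sum_(v <- V) t v * (dot u v + h).
Proof.
move=> t1 ->; under [RHS]eq_bigr => v _ do rewrite mulrDr -dotZr.
by rewrite big_split /= -dot_sumr -mulr_suml t1 mul1r.
Qed.

(* The barycentric coordinate of [v] is at most 1 on the simplex, with equality
   only at [v]. *)
Lemma simplex_vertex V V' v : #|` V| = d.+1 -> ~ on_common_hyperplane V ->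
  conv_hull V = conv_hull V' -> v \in V -> v \in V'.
Proof.
move=> cV nV eV vV; apply: contraPT isT => vV' _.
have [u [h uh]] := affine_interpolation 0 (fun w => (w == v)%:R) cV nV.
have {}uh w : w \in V -> dot u w + h = (w == v)%:R by move=> /uh; rewrite subr0.
have lt1 p : conv_hull V p -> p != v -> dot u p + h < 1.
  move=> [s [s0 s1 pE]] pv; rewrite (conv_affine u h s1 pE) (big_fsetD1 v) //=.
  rewrite uh // eqxx mulr1 big_seq big1 ?addr0 => [|w]; last first.
    by rewrite in_fsetD1 => /andP[/negbTE wv wV]; rewrite uh // wv mulr0.
  have sD0 : 0 <= \sum_(w <- (V `\ v)%fset) s w.
    by rewrite big_seq sumr_ge0 // => w; rewrite in_fsetD1 => /andP[_ /s0].
  rewrite lt_neqAle -{2}s1 (big_fsetD1 v) //= lerDl sD0 andbT.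
  apply: contra_neqN pv => /eqP sv1.
  have sV w : w \in (V `\ v)%fset -> s w = 0.
    move=> wV; apply/eqP; move: s1; rewrite (big_fsetD1 v) //= sv1 => /eqP.
    rewrite -subr_eq0 addrAC subrr add0r big_seq psumr_eq0; last first.
      by move=> i; rewrite in_fsetD1 => /andP[_ /s0].
    by move=> /allP/(_ w wV)/implyP; apply.
  rewrite pE (big_fsetD1 v) //= sv1 scale1r big_seq big1 ?addr0 // => w wV.
  by rewrite sV // scale0r.
have : conv_hull V' v by rewrite -eV; exact: conv_hull_vertex.
move=> [t [t0 t1 vE]].
(* All points of [V'] differ from [v], so their coordinate is below 1, while their average [v] has
   coordinate 1; this forces all weights to vanish. *)
have : \sum_(w <- V') t w * (1 - (dot u w + h)) = 0.
  under eq_bigr => w _ do rewrite mulrBr mulr1.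
  by rewrite sumrB -(conv_affine u h t1 vE) t1 uh // eqxx subrr.
move/eqP; rewrite big_seq psumr_eq0 => [/allP t'0|w wV']; last first.
  rewrite mulr_ge0 ?t0 // subr_ge0 ltW // lt1 //.
    by rewrite eV; exact: conv_hull_vertex.
  by apply: contraNneq vV' => <-.
suff : \sum_(w <- V') t w = 0 by rewrite t1 => /eqP; rewrite oner_eq0.
rewrite big_seq big1 // => w wV'; apply/eqP.
have := t'0 w wV'; rewrite wV' /= mulf_eq0 => /orP[//|].
rewrite gt_eqF // subr_gt0 lt1 //; first by rewrite eV; exact: conv_hull_vertex.
by apply: contraNneq vV' => <-.
Qed.

(** This allows simplices, given as subsets of space, to be counted by their vertex sets. *)
Lemma simplex_inj V V' : #|` V| = d.+1 -> #|` V'| = d.+1 ->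
  ~ on_common_hyperplane V -> conv_hull V = conv_hull V' -> V = V'.
Proof.
move=> cV cV' nV eV; apply/eqP; rewrite eqEfcard cV cV' leqnn andbT.
by apply/fsubsetP => v; exact: simplex_vertex.
Qed.

End ConvexHull.

(** * Subsets of a finite window as finite sets of points *)

Section SetsOfPoints.
Context {K : choiceType} (W : {fset K}).
Implicit Types (V : {set W}) (U : {fset K}).

Definition points V : {fset K} := [fset val a | a in V]%fset.

Lemma mem_points V (a : W) : (val a \in points V) = (a \in V).
Proof.
apply/imfsetP/idP => [[b /= bV /val_inj ->] //|aV]; by exists a.
Qed.

Lemma points_sub V : (points V `<=` W)%fset.
Proof. by apply/fsubsetP => _ /imfsetP[a _ ->]; exact: valP. Qed.

Lemma card_points V : #|` points V| = #|V|.
Proof. by rewrite card_imfset /= -?cardE //; exact: val_inj. Qed.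

Lemma points_inj : injective points.
Proof. by move=> V V' eV; apply/setP => a; rewrite -!mem_points eV. Qed.

Lemma pointsK U : (U `<=` W)%fset -> points [set a : W | val a \in U]%SET = U.
Proof.
move=> UW; apply/fsetP => a; apply/imfsetP/idP => [[b /= + ->]|aU].
  by rewrite inE.
by exists [` fsubsetP UW a aU]%fset; rewrite //= inE.
Qed.

Lemma points_subset V V' : (V \subset V') = (points V `<=` points V')%fset.
Proof.
apply/fintype.subsetP/fsubsetP => [VV' _ /imfsetP[a /= aV ->]|VV' a].
  by rewrite mem_points VV'.
by rewrite -!mem_points; exact: VV'.
Qed.

End SetsOfPoints.

(** * Hefty simplices around a point and their number *)

Section HeftySimplices.
Local Open Scope ring_scope.
Context {R : realType} {d : nat}.
Variables (A : set 'rV[R]_d) (x : 'rV[R]_d).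
Hypotheses (d0 : (0 < d)%N) (gA : generic A) (tA : thin_Delone A).
Hypothesis gx : generic_wrt A x.
Implicit Types (u v a c : 'rV[R]_d) (V B : {fset 'rV[R]_d}).

Definition simplex_around V :=
  [/\ [set` V] `<=` A, #|` V| = d.+1 & conv_hull V x].

(** The circumscribed sphere in the coordinates [(u, h)] of [power]; for a simplex around [x] such a
    pair exists and is unique. *)
Definition circum V : 'rV[R]_d * R :=
  xget (0, 0) [set p | forall v, v \in V -> power x p.1 p.2 v = 0].

Definition cpower V a := power x (circum V).1 (circum V).2 a.

Lemma cpower_vertex V v : simplex_around V -> v \in V -> cpower V v = 0.
Proof.
move=> [VA cV _]; move: v.
apply: (xgetPex (0, 0) (P := [set p | forall v, v \in V -> power x p.1 p.2 v = 0])).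
by have [u [h uh]] := exists_circumsphere x cV (gA.1 _ VA cV); exists (u, h).
Qed.

Lemma cpowerE V u h a : simplex_around V ->
  (forall v, v \in V -> power x u h v = 0) -> cpower V a = power x u h a.
Proof.
move=> sV pV; have [VA cV _] := sV; rewrite /cpower.
have pV' v : v \in V -> power x (circum V).1 (circum V).2 v = 0.
  by move=> vV; exact: cpower_vertex.
by have [-> ->] := circumsphere_unique cV (gA.1 _ VA cV) pV' pV.
Qed.

Lemma circum_gt0 V : simplex_around V -> 0 < (circum V).2.
Proof.
move=> sV; have [VA cV xV] := sV.
by apply: (conv_height_gt0 d0 tA.2 gx VA cV xV) => v; exact: cpower_vertex.
Qed.

Lemma heftyP k (s : set 'rV[R]_d) : hefty A k s /\ s x <->
  exists V, [/\ simplex_around V, s = conv_hull V &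
    A `&` [set a | cpower V a < 0] #= `I_k].
Proof.
split=> [[[V [VA [cV nV ->] [c [r [r0 Vc Ik]]]]] xV]|[V [sV -> Ik]]].
  have sV : simplex_around V by [].
  exists V; split=> //; congr (_ #= _) : Ik; congr (_ `&` _); apply/seteqP.
  (* The sphere of centre [c] and radius [r] in the coordinates of [power], found by inverting
     [power_sphere]. *)
  pose u := 2 *: (c - x); pose h := r ^+ 2 - dot (c - x) (c - x).
  have pE a : power x u h a = dot (a - c) (a - c) - r ^+ 2.
    have -> : a - c = (a - x) - (c - x) by rewrite opprB addrA subrK.
    rewrite /power /u /h; move: (a - x) (c - x) => y z.
    by rewrite !dotE (dotC y z); ring.
  have pV v : v \in V -> power x u h v = 0.
    by move=> /Vc /(enorm_eq _ (ltW r0)) vr; rewrite pE vr subrr.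
  split=> a /=; rewrite (cpowerE _ sV pV) pE subr_lt0;
    by move=> /(inside_sphereE _ _ r0).
have [VA cV xV] := sV; split=> //; exists V; split=> //.
  by split=> //; exact: gA.1.
set u := (circum V).1; set h := (circum V).2.
have r20 : 0 < h + dot u u / 4.
  by rewrite ltr_wpDr ?divr_ge0 ?dot_ge0 //; exact: circum_gt0.
have r0 : 0 < Num.sqrt (h + dot u u / 4) by rewrite sqrtr_gt0.
exists (x + 2^-1 *: u), (Num.sqrt (h + dot u u / 4)); split=> //.
  move=> v /= vV; apply/(enorm_eq _ (ltW r0)).
  rewrite sqr_sqrtr ?ltW // (power_sphere _ _ h).
  by rewrite -[power _ _ _ _]/(cpower V v) cpower_vertex // add0r.
congr (_ #= _) : Ik; congr (_ `&` _); apply/seteqP; split=> a /=.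
  move=> pa; apply/(inside_sphereE _ _ r0).
  by rewrite sqr_sqrtr ?ltW // (power_sphere _ _ h) gtrDr.
move=> /(inside_sphereE _ _ r0).
by rewrite sqr_sqrtr ?ltW // (power_sphere _ _ h) gtrDr.
Qed.

(** The hypotheses make [V] and [V'] empty simplices of [A] minus [B], which is still coarsely dense
    and generic. *)
Lemma empty_simplex_uniqueness B V V' : simplex_around V -> simplex_around V' ->
  [disjoint V & B]%fset -> [disjoint V' & B]%fset ->
  (forall a, A a -> cpower V a < 0 -> a \in B) ->
  (forall a, A a -> cpower V' a < 0 -> a \in B) -> V = V'.
Proof.
move=> sV sV' dV dV' hV hV'; have [VA cV xV] := sV; have [VA' cV' xV'] := sV'.
pose AB := A `\` [set` B].
have ABA : AB `<=` A by move=> a [].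
have sub U : [set` U] `<=` A -> [disjoint U & B]%fset -> [set` U] `<=` AB.
  by move=> UA /fdisjointP dU a /= aU; split; [exact: UA|exact/negP/dU].
have out U : (forall a, A a -> cpower U a < 0 -> a \in B) ->
    forall a, AB a -> 0 <= cpower U a.
  by move=> hU a [Aa /= aB]; rewrite leNgt; apply/negP => /(hU _ Aa).
apply: (empty_simplex_unique d0 (coarsely_denseD B tA.2) (genericW ABA gA)
  (generic_wrtW ABA gx) (sub _ VA dV) (sub _ VA' dV') cV cV' xV xV' _ _
  (out _ hV) (out _ hV')) => v; exact: cpower_vertex.
Qed.

Lemma empty_simplex_existence B : exists V, [/\ simplex_around V,
  [disjoint V & B]%fset & forall a, A a -> cpower V a < 0 -> a \in B].
Proof.
pose AB := A `\` [set` B].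
have ABA : AB `<=` A by move=> a [].
have tAB : thin_Delone AB.
  by split; [exact: locally_finiteD tA.1|exact: coarsely_denseD tA.2].
have [V [u [h [VAB cV xV pV pAB]]]] :=
  empty_simplex_exists d0 tAB (genericW ABA gA) (generic_wrtW ABA gx).
have sV : simplex_around V by split=> //; exact: subset_trans VAB ABA.
exists V; split=> //.
  by apply/fdisjointP => a /VAB[_ /= /negP].
move=> a Aa; rewrite (cpowerE _ sV pV) => pa; apply: contraPT isT => aB _.
by have := pAB a; rewrite leNgt pa => /(_ (conj Aa (negP aB))).
Qed.

(** The window [W] is finite by local finiteness. By [window_bound] it contains the vertices and
    inner points of every simplex around [x] with at most [k] inner points, so the count takes place
    among subsets of [W]. *)
Lemma card_simplices_around k :
  exists2 S : {fset {fset 'rV[R]_d}}, #|` S| = 'C(d + k, d) &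
    forall V, V \in S <->
      simplex_around V /\ A `&` [set a | cpower V a < 0] #= `I_k.
Proof.
have [rho rhoP] := window_bound x k d0 tA.2.
have fW := tA.1 x rho; pose W := fset_set (A `&` eclosed_ball x rho).
have WA a : a \in W -> A a by rewrite in_fset_set // => /set_mem[].
have inW V B a : simplex_around V -> (#|` B| <= k)%N ->
    (forall a, A a -> cpower V a < 0 -> a \in B) -> A a -> cpower V a <= 0 -> a \in W.
  move=> sV cB hB Aa pa; rewrite in_fset_set //; apply/mem_set; split=> //.
  exact: (rhoP B (circum V).1 (circum V).2 cB (ltW (circum_gt0 sV))).
(* The second condition ensures that [I V] below misses no inner point. *)
pose P (V : {set W}) := `[< simplex_around (points V) /\
  forall a, A a -> cpower (points V) a < 0 -> a \in W >].
pose I (V : {set W}) : {set W} := [set a | cpower (points V) (val a) < 0]%SET.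
have inI (V : {set W}) a : P V -> a \in points (I V) <-> A a /\ cpower (points V) a < 0.
  move=> /asboolP[sV hV]; split=> [aI|[Aa pa]].
    have aW := fsubsetP (points_sub _) _ aI.
    by move: aI; rewrite -[a]/(val [` aW]%fset) mem_points inE /= => pa; split=> //; exact: WA.
  by rewrite -[a]/(val [` hV a Aa pa]%fset) mem_points inE.
have dP (V V' : {set W}) : [disjoint V & V']%bool = [disjoint points V & points V']%fset.
  rewrite -finset.setI_eq0; apply/eqP/fdisjointP => [/finset.setP VV' a aV|VV'].
    have aW := fsubsetP (points_sub _) _ aV; have := VV' [` aW]%fset.
    rewrite !inE -!mem_points /= aV /=; case: (a \in _) => //.
  apply/finset.setP => a; rewrite !inE -!mem_points; case: (boolP (_ \in points V)) => //=.
  by move=> /VV' /negbTE.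
have cPI : #|[set V | P V && (#|I V| == k)]%SET| = 'C(d + k, d).
  apply: (@card_bases_of_level _ d k P I) => //.
  - by move=> V /asboolP[[_ + _] _]; rewrite card_points.
  - move=> V PV; rewrite dP; apply/fdisjointP => a aV; apply/negP => /(inI V a PV)[_].
    by have /asboolP[sV _] := PV; rewrite cpower_vertex // ltxx.
  (* The inner points of the empty simplex of [A] minus [B] all lie in [B], so the window bound puts
     its vertices in [W]. *)
  move=> B cB; have [V [sV dV hV]] := empty_simplex_existence (points B).
  have cB' : (#|` points B| <= k)%N by rewrite card_points.
  have VW : (V `<=` W)%fset.
    apply/fsubsetP => v vV; apply: (inW V (points B)) => //; last by rewrite cpower_vertex.
    by case: sV => VA _ _; exact: VA.
  have IB (V' : {set W}) : P V' -> (I V' \subset B) <->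
      (forall a, A a -> cpower (points V') a < 0 -> a \in points B).
    move=> PV'; rewrite points_subset; split=> [/fsubsetP IB a Aa pa|hB].
      by apply: IB; apply/inI.
    by apply/fsubsetP => a /(inI _ _ PV')[]; exact: hB.
  pose V0 := [set a : W | val a \in V]%SET.
  have V0E : points V0 = V by exact: pointsK.
  have PV0 : P V0.
    apply/asboolP; rewrite V0E; split=> // a Aa pa.
    by apply: (inW V (points B)) => //; exact: ltW.
  apply/eqP/cards1P; exists V0; apply/finset.setP => V1; rewrite !inE.
  apply/and3P/eqP => [[PV1 /(IB _ PV1) hV1 dV1]|->]; last first.
    split=> //; first by apply/(IB _ PV0); rewrite V0E.
    by rewrite disjoint_sym dP V0E.
  apply: points_inj; rewrite V0E; have /asboolP[sV1 _] := PV1.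
  apply: (empty_simplex_uniqueness sV1 sV _ dV hV1 hV).
  by rewrite -dP disjoint_sym.
exists [fset points V | V in [set V | P V && (#|I V| == k)]%SET]%fset.
  by rewrite card_imfset /= -?cardE //; exact: points_inj.
move=> V; split=> [/imfsetP[V0 /=]|[sV Ik]].
  rewrite inE => /andP[PV0 /eqP cI] ->; have /asboolP[sV0 _] := PV0; split=> //.
  have -> : A `&` [set a | cpower (points V0) a < 0] = [set` points (I V0)].
    by apply/seteqP; split=> a /=; [move=> ?; exact/inI|move/inI; exact].
  by apply/card_eq_fsetP; rewrite card_points.
have fI : finite_set (A `&` [set a | cpower V a < 0]) by exists k.
(* With the [k] inner points of [V] itself as [B], the window bound places [V] and these points in
   [W]. *)
pose B := fset_set (A `&` [set a | cpower V a < 0]).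
have cB : #|` B| = k by exact: card_fset_set.
have inB a : A a -> cpower V a < 0 -> a \in B.
  by move=> Aa pa; rewrite in_fset_set //; exact/mem_set.
have inWB a : A a -> cpower V a <= 0 -> a \in W by apply: (inW V B) => //; rewrite cB.
have VW : (V `<=` W)%fset.
  apply/fsubsetP => v vV; apply: inWB; last by rewrite cpower_vertex.
  by case: sV => VA _ _; exact: VA.
have V0E := pointsK VW; apply/imfsetP; exists [set a : W | val a \in V]%SET => //=.
have PV0 : P [set a : W | val a \in V]%SET.
  by apply/asboolP; rewrite V0E; split=> // a Aa /ltW; exact: inWB.
rewrite inE PV0 -card_points -cB /=; apply/eqP; congr #|` _|.
apply/fsetP => a; apply/idP/idP => [/(inI _ _ PV0)|]; rewrite ?V0E.
  by case; exact: inB.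
by rewrite in_fset_set // => /set_mem[Aa pa]; apply/(inI _ _ PV0); rewrite V0E.
Qed.

End HeftySimplices.

Theorem theorem2 (R : realType) (d : nat) (hd : (1 <= d)%N) (k : nat)
    (A : set 'rV[R]_d) (hgen : generic A) (hthin : thin_Delone A)
    (x : 'rV[R]_d) (hx : generic_wrt A x) :
  [set s : set 'rV[R]_d | hefty A k s /\ s x] #= `I_('C(d + k, d)).
Proof.
have [S cS SP] := card_simplices_around hd hgen hthin hx k.
(* The simplices are the image of the counted vertex sets under [conv_hull], which is injective on
   them. *)
rewrite (_ : [set s | _] = [set conv_hull V | V in [set` S]]).
  rewrite (card_eql (inj_card_eq _)); first exact/card_eq_fsetP.
  move=> V V' /set_mem/SP[[VA cV _] _] /set_mem/SP[[_ cV' _] _].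
  by apply: simplex_inj => //; exact: hgen.1.
apply/seteqP; split=> s /=.
  by move=> /(heftyP hd hgen hthin hx)[V [sV -> Ik]]; exists V => //; exact/SP.
by move=> [V /SP[sV Ik] <-]; apply/(heftyP hd hgen hthin hx); exists V.
Qed.
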